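(* Let $k,m\in\mathbb{N}_0$ and let $r_{k,m}=N_{k,m}/D_{k,m}$ be the $[k/m]$-Padé approximant of the exponential function, where $$N_{k,m}(z)=\sum_{i=0}^k\binom{k}{i}\frac{(k+m-i)!}{(k+m)!}\,z^i,\qquad D_{k,m}(z)=\sum_{i=0}^m\binom{m}{i}\frac{(k+m-i)!}{(k+m)!}\,(-z)^i.$$ Then $r_{k,m}(z)\ge0$ for all real $z\le0$ if and only if $k$ is even.
   Context: $\mathbb{N}_0$ denotes the non-negative integers; $k$ is the numerator degree and $m$ the denominator degree. *)

(* Defs.v *)
(* MathComp, with reals from MathComp-Analysis. *)
From mathcomp Require Import all_boot all_order all_algebra.
From mathcomp Require Import reals.

Set Implicit Arguments.
Unset Strict Implicit.
Unset Printing Implicit Defensive.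

Import Order.TTheory GRing.Theory Num.Theory.
Local Open Scope ring_scope.

(* All natural-number subtractions below satisfy i <= k + m, so none of them
   is truncated. *)
Definition pade_num (R : realType) (k m : nat) : {poly R} :=
  \sum_(i < k.+1)
    ('C(k, i)%:R * ((k + m - i)`!%:R / (k + m)`!%:R)) *: 'X^i.

Definition pade_den (R : realType) (k m : nat) : {poly R} :=
  \sum_(i < m.+1)
    ('C(m, i)%:R * ((k + m - i)`!%:R / (k + m)`!%:R)) *: (- 'X) ^+ i.

(* Values of the [k/m]-Pade approximant of exp. At a zero of the denominator
   the quotient is 0 by convention; by [pade_den_gt0] this does not occur for
   z <= 0. *)
Definition pade_exp (R : realType) (k m : nat) (z : R) : R :=
  (pade_num R k m).[z] / (pade_den R k m).[z].

Lemma pade_den_gt0 (R : realType) (k m : nat) (z : R) :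
  z <= 0 -> 0 < (pade_den R k m).[z].
Proof.
move=> z0; rewrite /pade_den horner_sum big_ord_recl /=.
rewrite expr0 hornerZ hornerC mulr1 bin0 mul1r subn0 divff; last first.
  by rewrite pnatr_eq0 -lt0n fact_gt0.
rewrite ltr_wpDr ?ltr01 // sumr_ge0 // => i _.
rewrite hornerZ horner_exp hornerN hornerX mulr_ge0 ?exprn_ge0 ?oppr_ge0 //.
by rewrite mulr_ge0 ?divr_ge0 ?ler0n.
Qed.

(* Main.v *)
Require Import Defs.
From HB Require Import structures.
From mathcomp Require Import all_boot all_order all_algebra.
From mathcomp Require Import reals.
From mathcomp Require Import ring polyrcf.

(** The denominator is positive on the half-line [z <= 0], so only the sign of
    the numerator matters.  Up to the factor [(k + m)!], the numerator is
    [\int_0^oo t^m (t + z)^k e^(-t) dt], because [\int_0^oo t^n e^(-t) dt = n!].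

    When [k = 2h] the integrand is nonnegative, hence so is the integral, for
    every real [z].  The argument can be made purely algebraic: the integral is
    the value on [('X + z)^k = (('X + z)^h)^2] of the linear functional sending
    ['X^i] to [(i + m)!], and this functional is nonnegative on squares since
    its Hankel matrix [(i + j + m)!] has an explicit [L D L^T] factorization
    with a positive diagonal [D] ([fact_hankel_decomposition]).  That
    factorization is Vandermonde's convolution for binomial coefficients; it
    encodes the orthogonality of the generalized Laguerre polynomials.

    When [k] is odd, the numerator has odd degree [k] and a positive leading
    coefficient, so it tends to [-oo] at [-oo]. *)

Set Implicit Arguments.
Unset Strict Implicit.
Unset Printing Implicit Defensive.

Import Order.TTheory GRing.Theory Num.Theory.
Local Open Scope ring_scope.

(** Both sides, multiplied by [(i - l)!], equal [(i + m)! * i!].  This trades the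
    summands of Vandermonde's convolution, which treat its two indices
    differently, for the symmetric ones of [fact_hankel_decomposition]. *)
Lemma fact_bin_exchange (m i l : nat) : (l <= i)%N ->
  (l`! * ((i + m)`! * 'C(i, l)) = i`! * 'C(i + m, i - l) * (l + m)`!)%N.
Proof.
move=> li; apply/eqP; rewrite -(eqn_pmul2r (fact_gt0 (i - l))); apply/eqP.
have Ei := bin_fact li.
have le_im : (i - l <= i + m)%N by rewrite (leq_trans (leq_subr l i)) ?leq_addr.
have := bin_fact le_im.
have -> : (i + m - (i - l) = l + m)%N.
  by rewrite -{1}(subnK li) -addnA addKn.
move=> Eim; transitivity ((i + m)`! * i`!)%N.
  by rewrite -Ei; ring.
by rewrite -Eim; ring.
Qed.

(** The [L D L^T] factorization of the Hankel matrix of the moments [(i + m)!]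
    of the weight [t^m e^(-t)]: it is [(i + j + m)! = i! (j + m)! C(i + j + m, i)]
    with the binomial coefficient expanded by Vandermonde's convolution. *)
Lemma fact_hankel_decomposition (R : numFieldType) (m n i j : nat) :
  (i < n)%N ->
  (i + j + m)`!%:R = \sum_(l < n) l`!%:R / (l + m)`!%:R *
    (((i + m)`! * 'C(i, l))%:R * ((j + m)`! * 'C(j, l))%:R) :> R.
Proof.
move=> lt_in.
have -> : ((i + j + m)`! = \sum_(l < i.+1)
    i`! * 'C(i + m, i - l) * ((j + m)`! * 'C(j, l)))%N.
  have le_i : (i <= j + (i + m))%N by rewrite addnCA leq_addr.
  have -> : (i + j + m = j + (i + m))%N by ring.
  rewrite -(bin_fact le_i) -binomial.Vandermonde addnCA addKn big_distrl /=.
  by apply: eq_bigr => l _; ring.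
rewrite natr_sum (big_ord_widen n (fun l =>
  (i`! * 'C(i + m, i - l) * ((j + m)`! * 'C(j, l)))%:R)) // big_mkcond /=.
apply: eq_bigr => l _; rewrite ltnS; case: leqP => [li|il]; last first.
  by rewrite (bin_small il) muln0 mul0r mulr0.
have lm0 : (l + m)`!%:R != 0 :> R by rewrite pnatr_eq0 -lt0n fact_gt0.
apply: (mulIf lm0).
rewrite [RHS]mulrAC divfK // -!natrM; congr (_%:R).
by rewrite [RHS]mulnA fact_bin_exchange // mulnAC.
Qed.

(** The functional [\int_0^oo t^m p(t) e^(-t) dt], for [size p <= n].  The bound
    [n] is a parameter, rather than [size p], so that linearity in [p] is
    immediate. *)
Definition gamma_moment (R : nzRingType) (m n : nat) (p : {poly R}) : R :=
  \sum_(i < n) p`_i * (i + m)`!%:R.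

Lemma gamma_moment_is_linear (R : nzRingType) (m n : nat) :
  linear_for *%R (@gamma_moment R m n).
Proof.
move=> a p q; rewrite /gamma_moment big_distrr -big_split /=.
by apply: eq_bigr => i _; rewrite coefD coefZ mulrDl mulrA.
Qed.

HB.instance Definition _ (R : nzRingType) (m n : nat) :=
  GRing.isLinear.Build R {poly R} R _ (@gamma_moment R m n)
    (@gamma_moment_is_linear R m n).

Lemma gamma_momentXn (R : nzRingType) (m n i : nat) : (i < n)%N ->
  gamma_moment m n 'X^i = (i + m)`!%:R :> R.
Proof.
move=> lt_in; rewrite /gamma_moment (bigD1 (Ordinal lt_in)) //= coefXn eqxx.
rewrite mul1r big1 ?addr0 // => j /eqP ne_ji; rewrite coefXn.
by case: eqP => [eq_ji|]; rewrite ?mul0r //; case: ne_ji; apply: val_inj.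
Qed.

(** In the coefficients of [q], the value on [q ^+ 2] is the quadratic form of the
    Hankel matrix of factorials, which the [L D L^T] factorization turns into a
    sum of squares with positive weights. *)
Lemma gamma_moment_sqr_ge0 (R : realFieldType) (m n h : nat) (q : {poly R}) :
  (size q <= h.+1)%N -> (h + h < n)%N -> 0 <= gamma_moment m n (q ^+ 2).
Proof.
move=> size_q lt_hn.
have Eq : q = \sum_(i < h.+1) q`_i *: 'X^i.
  rewrite -poly_def; apply/polyP => i; rewrite coef_poly.
  by case: ltnP => // /(leq_trans size_q)/(nth_default 0).
have -> : gamma_moment m n (q ^+ 2) =
    \sum_(l < h.+1) l`!%:R / (l + m)`!%:R *
      (\sum_(i < h.+1) q`_i * ((i + m)`! * 'C(i, l))%:R) ^+ 2.
  rewrite expr2 [in LHS]Eq big_distrlr /= linear_sum /=.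
  under eq_bigr => i _ do rewrite linear_sum /=.
  under [RHS]eq_bigr => l _.
    rewrite expr2 big_distrlr mulr_sumr /=.
    under eq_bigr => i _ do rewrite mulr_sumr.
    over.
  rewrite [RHS]exchange_big /=; apply: eq_bigr => i _.
  rewrite [RHS]exchange_big /=; apply: eq_bigr => j _.
  rewrite -scalerAl -scalerAr -exprD !linearZ /= gamma_momentXn; last first.
    by apply: leq_ltn_trans lt_hn; rewrite leq_add // -ltnS ltn_ord.
  rewrite (fact_hankel_decomposition R m j (ltn_ord i)) mulrA mulr_sumr.
  by apply: eq_bigr => l _; ring.
by apply: sumr_ge0 => l _; rewrite mulr_ge0 ?sqr_ge0 // divr_ge0.
Qed.

(** Expanding [('X + z)^k] by the binomial theorem and evaluating monomial by
    monomial gives the numerator, term for term; in analytic terms,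
    [(k + m)! N(z) = \int_0^oo t^m (t + z)^k e^(-t) dt]. *)
Lemma pade_num_gamma_moment (R : realType) (k m : nat) (z : R) :
  (k + m)`!%:R * (pade_num R k m).[z] =
    gamma_moment m k.+1 (('X + z%:P) ^+ k).
Proof.
rewrite exprDn linear_sum /= /pade_num horner_sum mulr_sumr.
apply: eq_bigr => i _; rewrite -polyC_exp ['X^_ * _]mulrC mul_polyC -scaler_nat scalerA.
rewrite linearZ /= gamma_momentXn ?ltnS ?leq_subr // hornerZ hornerXn.
have km0 : (k + m)`!%:R != 0 :> R by rewrite pnatr_eq0 -lt0n fact_gt0.
rewrite (addnBAC m (leq_ord i)).
by rewrite mulrA [_ * (_ * (_ / _))]mulrCA [_ * (_ / _)]mulrCA mulfV // mulr1
  mulrAC.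
Qed.

Lemma pade_num_even_ge0 (R : realType) (k m : nat) (z : R) :
  ~~ odd k -> 0 <= (pade_num R k m).[z].
Proof.
move=> even_k; have Ek : k = (k./2 + k./2)%N.
  by rewrite addnn -[LHS]odd_double_half (negbTE even_k).
have km0 : 0 < (k + m)`!%:R :> R by rewrite ltr0n fact_gt0.
rewrite -(pmulr_rge0 _ km0) pade_num_gamma_moment.
have -> : ('X + z%:P) ^+ k = (('X + z%:P) ^+ k./2) ^+ 2.
  by rewrite -exprM muln2 -addnn -Ek.
apply: (@gamma_moment_sqr_ge0 _ _ _ k./2); last by rewrite -Ek.
by rewrite (leq_trans (size_poly_exp_leq _ _)) // size_XaddC mul1n.
Qed.

Lemma pade_num_lead (R : realType) (k m : nat) :
  size (pade_num R k m) = k.+1 /\ 0 < lead_coef (pade_num R k m).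
Proof.
have Ec : 'C(k, k)%:R * ((k + m - k)`!%:R / (k + m)`!%:R) > 0 :> R.
  by rewrite binn mul1r divr_gt0 // ltr0n fact_gt0.
have E : pade_num R k m =
    \poly_(i < k.+1) ('C(k, i)%:R * ((k + m - i)`!%:R / (k + m)`!%:R)).
  by rewrite poly_def.
by rewrite E size_poly_eq ?lead_coef_poly // gt_eqF.
Qed.

(** Substituting [- 'X] turns the limit at [-oo] into one at [+oo], where the
    sign of a polynomial is that of its leading coefficient. *)
Lemma pade_num_odd_lt0 (R : realType) (k m : nat) :
  odd k -> exists2 z : R, z <= 0 & (pade_num R k m).[z] < 0.
Proof.
move=> odd_k; have [size_N lead_N] := pade_num_lead R k m.
pose p := - (pade_num R k m \Po (- 'X)).
have size_X : size (- 'X : {poly R}) = 2 by rewrite size_polyN size_polyX.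
have lead_p : 0 < lead_coef p.
  rewrite lead_coefN lead_coef_comp ?size_X // size_N /= lead_coefN lead_coefX.
  by rewrite -signr_odd odd_k expr1 mulrN1 opprK.
have [x0 px0] := poly_pinfty_gt_lc lead_p.
exists (- Num.max x0 0); first by rewrite oppr_le0 le_max lexx orbT.
have := lt_le_trans lead_p (px0 (Num.max x0 0) _).
rewrite le_max lexx => /(_ isT).
by rewrite hornerN horner_comp hornerN hornerX oppr_gt0.
Qed.

Theorem theorem10 (R : realType) (k m : nat) :
  (forall z : R, z <= 0 -> 0 <= pade_exp k m z) <-> ~~ odd k.
Proof.
split=> [ge0 | even_k z z0]; last first.
  by rewrite divr_ge0 ?pade_num_even_ge0 // ltW // pade_den_gt0.
apply/negP => odd_k; have [z z0 Nz] := pade_num_odd_lt0 R m odd_k.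
have := ge0 z z0; rewrite /pade_exp pmulr_lge0 ?invr_gt0 ?pade_den_gt0 //.
by rewrite leNgt Nz.
Qed.
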